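(* Let $n,\lambda\ge 0$ be integers and let $\alpha,x,m,r$ be positive integers such that $\alpha\mid m$ and $\alpha\mid r$. Then $$D^{\lambda,x}_{m,r}(n;\alpha)=\sum_{k=0}^{n}(x\lambda)^{k}\,S(n,k;\alpha,m,r).$$
   Context: Write $e_\alpha^{s}(z)=(1+\alpha z)^{s/\alpha}$. The higher order degenerate $r$-Dowling polynomials $D^{\lambda,x}_{m,r}(n;\alpha)$, $n\ge 0$, are given by the formal power series identity $$\sum_{n=0}^{\infty}D^{\lambda,x}_{m,r}(n;\alpha)\frac{z^n}{n!}=e_\alpha^{r}(z)\,\exp\left(x\lambda\,\frac{e_\alpha^{m}(z)-1}{m}\right).$$ The generalized Stirling numbers $S(n,k;\alpha,m,r)$ are defined by $$\sum_{n\ge 0}S(n,k;\alpha,m,r)\frac{z^n}{n!}=\frac{e_\alpha^{r}(z)}{k!}\left(\frac{e_\alpha^{m}(z)-1}{m}\right)^k .$$ The convention $0^0=1$ is used. *)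

(* Defs.v *)
From mathcomp Require Import all_boot all_order all_algebra.

Set Implicit Arguments.
Unset Strict Implicit.
Unset Printing Implicit Defensive.

Import Order.TTheory GRing.Theory Num.Theory.
Local Open Scope ring_scope.

(* Formal power series over rat, as coefficient sequences:
   f stands for \sum_n f n * z^n. *)
Definition fps : Type := nat -> rat.

Definition fps_one : fps := fun n => (n == 0%N)%:R.

Definition fps_sub (f g : fps) : fps := fun n => f n - g n.

Definition fps_scale (c : rat) (f : fps) : fps := fun n => c * f n.

Definition fps_mul (f g : fps) : fps :=
  fun n => \sum_(i < n.+1) f i * g (n - i)%N.

Fixpoint fps_pow (f : fps) (k : nat) : fps :=
  if k is k'.+1 then fps_mul f (fps_pow f k') else fps_one.

(* \sum_k f k * g^k, for g with zero constant term: then g^k has no term of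
   degree < k, so only k <= n contribute to degree n (see fps_comp_trunc). *)
Definition fps_comp (f g : fps) : fps :=
  fun n => \sum_(k < n.+1) f k * fps_pow g k n.

Definition fps_exp : fps := fun n => (n`!%:R)^-1.

Definition gbinom (a : rat) (k : nat) : rat :=
  (\prod_(i < k) (a - i%:R)) / k`!%:R.

(* Newton's binomial series of (1 + alpha z)^(s / alpha), for alpha != 0. *)
Definition degexp (alpha s : rat) : fps :=
  fun n => gbinom (s / alpha) n * alpha ^+ n.

(* (e_alpha^m(z) - 1) / m *)
Definition degexp_quot (alpha m : rat) : fps :=
  fps_scale m^-1 (fps_sub (degexp alpha m) fps_one).

(* The sequence whose exponential generating function is f. *)
Definition egf_coef (f : fps) (n : nat) : rat := n`!%:R * f n.

Definition dowling (lambda x m r alpha : rat) (n : nat) : rat :=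
  egf_coef
    (fps_mul (degexp alpha r)
       (fps_comp fps_exp (fps_scale (x * lambda) (degexp_quot alpha m)))) n.

Definition gstirling (n k : nat) (alpha m r : rat) : rat :=
  egf_coef
    (fps_mul (fps_scale (k`!%:R)^-1 (degexp alpha r))
       (fps_pow (degexp_quot alpha m) k)) n.

Lemma egf_coefK (f : fps) (n : nat) : egf_coef f n / n`!%:R = f n.
Proof. by rewrite /egf_coef mulrAC divff ?mul1r// pnatr_eq0 -lt0n fact_gt0. Qed.

Lemma fps_pow_lt (g : fps) (k n : nat) :
  g 0%N = 0 -> (n < k)%N -> fps_pow g k n = 0.
Proof.
move=> g0; elim: k n => [//|k IHk] n /= lt_nk.
rewrite /fps_mul big1// => -[[|i] lt_i] _ /=; first by rewrite g0 mul0r.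
rewrite ltnS in lt_i; rewrite IHk ?mulr0// -ltnS (leq_trans _ lt_nk)// !ltnS.
by rewrite ltn_subrL (leq_trans _ lt_i).
Qed.

Lemma fps_comp_trunc (f g : fps) (n N : nat) : g 0%N = 0 -> (n < N)%N ->
  \sum_(k < N) f k * fps_pow g k n = fps_comp f g n.
Proof.
move=> g0 lt_nN; rewrite /fps_comp.
rewrite (big_ord_widen _ (fun k => f k * fps_pow g k n) lt_nN) [RHS]big_mkcond.
apply: eq_bigr => k _.
by case: ifPn => //; rewrite -leqNgt => lt_nk; rewrite fps_pow_lt ?mulr0.
Qed.

Lemma degexp_quot0 (alpha m : rat) : degexp_quot alpha m 0%N = 0.
Proof.
rewrite /degexp_quot /fps_scale /fps_sub /degexp /gbinom /fps_one.
by rewrite big_ord0 fact0 expr0 invr1 !mulr1 subrr mulr0.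
Qed.

Lemma degexp_nat (alpha q n : nat) : (0 < alpha)%N ->
  degexp alpha%:R (alpha * q)%:R n = ((1 + alpha%:R *: 'X) ^+ q)`_n.
Proof.
move=> alpha0; have a0 : alpha%:R != 0 :> rat by rewrite pnatr_eq0 -lt0n.
rewrite /degexp [_ / _](_ : _ = q%:R); last by rewrite mulnC natrM mulfK.
have -> : gbinom q%:R n = 'C(q, n)%:R.
  apply: (mulIf (x := n`!%:R)); first by rewrite pnatr_eq0 -lt0n fact_gt0.
  rewrite mulfVK ?pnatr_eq0 -?lt0n ?fact_gt0// -natrM bin_ffact.
  elim: n => [|n IHn]; first by rewrite big_ord0.
  rewrite big_ord_recr /= IHn ffactnSr natrM.
  by case: (leqP n q) => [/natrB->//|/ffact_small->]; rewrite !mul0r.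
rewrite exprDn coef_sum.
under eq_bigr => i _ do
  rewrite expr1n mul1r coefMn exprZn coefZ coefXn.
case: (ltnP n q.+1) => [lt_nq|lt_qn].
  rewrite (bigD1 (Ordinal lt_nq)) //= eqxx mulr1 big1 ?addr0 => [|i ne_in].
    by rewrite mulr_natl.
  by rewrite eq_sym -val_eqE /= in ne_in *; rewrite (negbTE ne_in) mulr0 mul0rn.
rewrite bin_small// mul0r big1// => i _.
by rewrite gtn_eqF ?mulr0 ?mul0rn// (leq_trans _ lt_qn).
Qed.

(* Main.v *)
Require Import Defs.
From mathcomp Require Import all_boot all_order all_algebra.

Import GRing.Theory Num.Theory.
Local Open Scope ring_scope.

(** Expand the exponential in the generating function of the Dowling
    polynomials as [\sum_k (x * lambda)^k / k! * ((e_alpha^m(z) - 1) / m)^k],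
    distribute the factor [e_alpha^r(z)] over it, and recognise the [k]-th
    summand as [(x * lambda)^k] times the generating function of the
    generalized Stirling numbers.  The sum stops at [k = n] because
    [(e_alpha^m(z) - 1) / m] has zero constant term: its [k]-th power starts in
    degree [k], so only [k <= n] reaches degree [n].  [fps_mul_compr] is this
    distribution of a product over a composition, with the truncation made
    uniform in the degree, and [fps_pow_scale] pulls out [(x * lambda)^k]. *)

Lemma fps_pow_scale (c : rat) (g : fps) (k n : nat) :
  fps_pow (fps_scale c g) k n = c ^+ k * fps_pow g k n.
Proof.
elim: k n => [|k IHk] n /=; first by rewrite expr0 mul1r.
rewrite /fps_mul mulr_sumr; apply: eq_bigr => i _.
by rewrite IHk /fps_scale mulrACA -exprS.
Qed.

(** The coefficient of degree [n - i] of [fps_comp h g] is by definition a sum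
    over [k <= n - i]; as [g] has no constant term, it may be extended to
    [k <= n] for every [i], after which the two sums can be exchanged. *)
Lemma fps_mul_compr (f h g : fps) (n : nat) : g 0%N = 0 ->
  fps_mul f (fps_comp h g) n =
  \sum_(k < n.+1) h k * fps_mul f (fps_pow g k) n.
Proof.
move=> g0; rewrite /fps_mul.
under [RHS]eq_bigr => k _ do rewrite mulr_sumr.
rewrite exchange_big /=; apply: eq_bigr => i _.
rewrite -(@fps_comp_trunc h g (n - i) n.+1 g0) ?ltnS ?leq_subr//.
by rewrite mulr_sumr; apply: eq_bigr => k _; rewrite mulrCA.
Qed.

Theorem theorem4p2 (n lambda alpha x m r : nat)
    (alpha_gt0 : (0 < alpha)%N) (x_gt0 : (0 < x)%N)
    (m_gt0 : (0 < m)%N) (r_gt0 : (0 < r)%N)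
    (alpha_dvd_m : (alpha %| m)%N) (alpha_dvd_r : (alpha %| r)%N) :
  dowling lambda%:R x%:R m%:R r%:R alpha%:R n =
  \sum_(0 <= k < n.+1)
    (x%:R * lambda%:R) ^+ k * gstirling n k alpha%:R m%:R r%:R.
Proof.
rewrite /dowling /gstirling /egf_coef fps_mul_compr; last first.
  by rewrite /fps_scale degexp_quot0 mulr0.
rewrite big_mkord mulr_sumr; apply: eq_bigr => k _.
rewrite [RHS]mulrCA; congr (_ * _).
rewrite /fps_mul !mulr_sumr; apply: eq_bigr => i _.
rewrite fps_pow_scale /fps_exp /fps_scale.
by rewrite [degexp _ _ _ * (_ * _)]mulrCA [LHS]mulrCA -[in RHS]mulrA.
Qed.
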